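(* For every integer $k\ge 0$, the $k$th classical numerator $C_k$ and denominator $D_k$ of the continued fraction $$\cfrac{-1+a_1}{1+\cfrac{-1+a_2}{1+\cfrac{-1+a_3}{1+\cdots}}}$$ in noncommuting indeterminates $a_1,a_2,\dots$ are $$C_k=-\sigma(k)+\sum_{m \in \mathcal{U}_{k-1} } (-1)^{g_{k-1}(m)}\, m+\sum_{m \in \mathcal{U}_k } (-1)^{g_k(m)}\, m,$$ and $$D_k=\sigma(k+1)-\sum_{\substack{m \in \mathcal{U}_k \\ \lambda_\ell>1}} (-1)^{g_{k}(m)}\phi(m)-\sum_{\substack{m\in \mathcal{U}_{k+1} \\ \lambda_\ell>1}} (-1)^{g_{k+1}(m)} \phi(m),$$ where in the sums for $D_k$, $\lambda_\ell$ is the last (smallest) component of the index of $m$.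
   Context: The classical numerators and denominators are the polynomials with integer coefficients in the noncommuting indeterminates $a_1,a_2,\dots$ defined by $C_0=0$, $C_1=-1+a_1$, $D_0=1$, $D_1=1$, and $X_k=(-1+a_k)X_{k-2}+X_{k-1}$ for $k\ge2$, for both $X=C$ and $X=D$. For an integer $k\ge -1$, $\mathcal{U}_k$ is the set of monomials $m=a_{\lambda_1}a_{\lambda_2}\cdots a_{\lambda_\ell}$, $\ell\ge 1$, whose index $[\lambda_1,\dots,\lambda_\ell]$ satisfies: (U1) $k\ge\lambda_1>\lambda_2>\dots>\lambda_\ell\ge1$; (U2) $\lambda_1\equiv k\pmod 3$; (U3) $\lambda_j\not\equiv\lambda_{j+1}+1\pmod 3$ for $1\le j<\ell$; (U4) $\lambda_\ell\not\equiv 2\pmod 3$. (In particular $\mathcal{U}_{-1}=\mathcal{U}_0=\emptyset$.) For $m\in\mathcal{U}_k$ with index $[\lambda_1,\dots,\lambda_\ell]$, $g_k(m)$ is the maximum number of pairwise disjoint sets of three consecutive integers whose union is a subset of $\{-1,0,1,\dots,k\}\setminus\{\lambda_1,\dots,\lambda_\ell\}$. $\sigma(k)=\frac{2\sqrt3}{3}\sin\left(\frac{k\pi}{3}\right)$, the 6-periodic sequence $0,1,1,0,-1,-1,\dots$ for $k=0,1,2,\dots$. $\phi$ is the substitution ring homomorphism with $\phi(a_1)=0$ and $\phi(a_j)=a_{j-1}$ for $j>1$. *)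

(* Defs.v *)
From HB Require Import structures.
From mathcomp Require Import all_boot all_order all_algebra.
From mathcomp Require Import finmap.
From mathcomp Require Import monalg.
From mathcomp Require Import reals trigo.
From mathcomp Require Import ring lra zify.

Set Implicit Arguments.
Unset Strict Implicit.
Unset Printing Implicit Defensive.

Import Order.TTheory GRing.Theory Num.Theory.

Local Open Scope ring_scope.

(* Polynomials with integer coefficients in the noncommuting indeterminates   *)
(* a_1, a_2, ...: the monoid ring over int of the free monoid on nat, in      *)
(* which the generator numbered i stands for a_(i+1).  There is thus no a_0;  *)
(* the value a 0 is junk.                                                     *)
Notation ncpoly := {malg int[{fmonom nat}]}.

Definition a (j : nat) : ncpoly := << fmu j.-1 >>.

(* lambda m = [:: lambda_1; ...; lambda_l] for m = a_lambda_1 ... a_lambda_l. *)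
Definition lambda (m : {fmonom nat}) : seq nat := [seq i.+1 | i <- m : seq nat].

Fixpoint cf_rec (x0 x1 : ncpoly) (k : nat) : ncpoly :=
  match k with
  | 0 => x0
  | 1 => x1
  | (k''.+1 as k').+1 => (-1 + a k) * cf_rec x0 x1 k'' + cf_rec x0 x1 k'
  end.

Definition C : nat -> ncpoly := cf_rec 0 (-1 + a 1).
Definition D : nat -> ncpoly := cf_rec 1 1.

Definition U_index (k : int) (l : seq nat) : bool :=
  [&& (1 <= size l)%N,
      [&& (head 0%N l)%:Z <= k, sorted gtn l & (1 <= last 0 l)%N],
      ((head 0%N l)%:Z == k %[mod 3])%Z,
      sorted (fun x y => x != y + 1 %[mod 3])%N l
    & (last 0 l != 2 %[mod 3])%N].

(* The words enumerated here have length and letters bounded by |k|; in_U     *)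
(* below shows that this loses nothing.                                       *)
Definition U (k : int) : {fset {fmonom nat}} :=
  [fset m in [seq FMonom [seq val i | i <- t : seq 'I_`|k|%N]
             | t : {bseq `|k|%N of 'I_`|k|%N}]
  | U_index k (lambda m)]%fset.

(* {-1, 0, ..., k} minus the components of the index of m (for k >= -1).      *)
Definition gaps (k : int) (m : {fmonom nat}) : {fset int} :=
  ([fset (i%:Z - 1)%R | i in iota 0 (absz (k + 2)%R)]
     `\` [fset j%:Z | j in lambda m])%fset.

Definition three_consecutive (B : {fset int}) : bool :=
  [exists x : B, B == [fset val x; (val x + 1)%R; (val x + 2)%R]%fset].

Definition g (k : int) (m : {fmonom nat}) : nat :=
  \max_(F <- fpowerset (fpowerset (gaps k m))
       | trivIfset F && [forall B : F, three_consecutive (val B)]) #|` F|.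

Definition phi_gen (i : nat) : ncpoly := if i is i'.+1 then a i else 0.

Definition phi_mon (m : {fmonom nat}) : ncpoly :=
  \prod_(i <- m : seq nat) phi_gen i.

Definition phi : ncpoly -> ncpoly := mmap intr phi_mon.

(* The value is an integer (sigmaE): the floor only casts it to int.          *)
Definition sigma (R : realType) (k : nat) : int :=
  Num.floor (2 * Num.sqrt 3 / 3 * sin (k%:R * pi / 3) : R).

Lemma malgUM (m1 m2 : {fmonom nat}) :
  << mmul m1 m2 >> = << m1 >> * << m2 >> :> ncpoly.
Proof. by rewrite malgM_def fgmulUU mulr1. Qed.

Lemma aE (m : {fmonom nat}) : << m >> = \prod_(j <- lambda m) a j :> ncpoly.
Proof.
case: m => s; rewrite /lambda big_map /=.
elim: s => [|i s IH].
  by rewrite big_nil -fmoneE.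
rewrite big_cons -IH -malgUM; congr (<< _ >>).
by apply/eqP; rewrite fmP /= fmM fmU.
Qed.

Lemma in_U (k : int) (m : {fmonom nat}) : (m \in U k) = U_index k (lambda m).
Proof.
rewrite /U in_fset inE /=; apply/andP/idP => [[] //|Um]; split=> //.
case: k m Um => [k|k] m /and5P[sz /and3P[hk srt l1] _ _ _]; last first.
  by move: hk; rewrite leNgt (lt_le_trans (y := 0)).
have ltmk i : i \in (m : seq nat) -> (i < k)%N.
  move=> im; have : i.+1 \in lambda m by rewrite map_f.
  move: hk srt; case: (lambda m) => //= h t hk pt.
  rewrite inE => /predU1P[->|]; first by rewrite -lez_nat.
  move=> it; have /allP/(_ _ it) := order_path_min (rev_trans ltn_trans) pt.
  by move=> /= lt; move: hk; rewrite lez_nat => hk; apply: leq_trans hk; apply: ltnW.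
have uq : uniq (m : seq nat).
  have : uniq (lambda m).
    by apply: sorted_uniq srt => [|x]; [apply: rev_trans ltn_trans | apply: ltnn].
  exact: map_uniq.
have szm : (size (m : seq nat) <= k)%N.
  rewrite -(size_iota 0 k); apply: uniq_leq_size uq _ => i /ltmk.
  by rewrite mem_iota.
have [t mt] : exists t : seq 'I_k, [seq val i | i <- t] = m.
  elim: (m : seq nat) ltmk {szm uq} => [|i s IH] lts; first by exists [::].
  have [|t <-] := IH; first by move=> j js; apply: lts; rewrite inE js orbT.
  by exists (Ordinal (lts i (mem_head _ _)) :: t).
have szt : (size t <= k)%N by rewrite -(size_map val) mt.
apply/imageP; exists (Bseq szt) => //=.
by rewrite mt fmK.
Qed.

Fact phi_mon_mmorphism : mmorphism phi_mon.
Proof.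
split=> [m1 m2|]; first by rewrite /phi_mon fmM big_cat.
by rewrite /phi_mon fm1 big_nil.
Qed.

HB.instance Definition _ :=
  isMultiplicative.Build {fmonom nat} ncpoly phi_mon phi_mon_mmorphism.

Fact phi_is_additive : zmod_morphism phi.
Proof. exact: mmap_is_additive. Qed.

HB.instance Definition _ :=
  GRing.isZmodMorphism.Build ncpoly ncpoly phi phi_is_additive.

Fact phi_is_monoid_morphism : monoid_morphism phi.
Proof.
have [] : {morph phi : p q / p * q} * (phi 1 = 1); last by [].
by apply: commr_mmap_is_multiplicative => *; apply/commr_sym/commr_int.
Qed.

HB.instance Definition _ :=
  GRing.isMonoidMorphism.Build ncpoly ncpoly phi phi_is_monoid_morphism.

Lemma phi_a1 : phi (a 1) = 0.
Proof. by rewrite /phi mmapU mul1r /phi_mon fmU big_seq1. Qed.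

Lemma phi_a (j : nat) : (1 < j)%N -> phi (a j) = a j.-1.
Proof.
by case: j => [|[|j]] // _; rewrite /phi mmapU mul1r /phi_mon fmU big_seq1.
Qed.

Lemma sin_pi3 (R : realType) : sin (pi / 3 : R) = Num.sqrt 3 / 2.
Proof.
set x : R := pi / 3; set s := sin x.
have p0 := pi_gt0 R.
have s0 : 0 < s by apply: sin_gt0_pi; rewrite /x; apply/andP; split; lra.
have e : sin (x + x + x) = 0.
  by rewrite (_ : x + x + x = pi) ?sinpi // /x; field.
have c2 := cos2sin2 x; rewrite -/s in c2.
rewrite !(sinD, cosD) -/s in e.
have s2 : s ^+ 2 = 3 / 4.
  have /eqP : s * (3 - 4 * s ^+ 2) = 0.
    rewrite -[RHS]e; transitivity (s * (3 * cos x ^+ 2 - s ^+ 2)); last by ring.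
    by rewrite c2; ring.
  rewrite mulf_eq0 gt_eqF //= => /eqP; lra.
have q2 : Num.sqrt 3 ^+ 2 = 3 :> R by rewrite sqr_sqrtr.
apply/eqP; rewrite -(eqrXn2 (n := 2)) ?ltW //.
- by rewrite s2 exprMn q2; apply/eqP; field.
- by rewrite divr_gt0 // sqrtr_gt0.
Qed.

Definition sigma_seq : seq int := [:: 0; 1; 1; 0; -1; -1].

Lemma sigma_formula (R : realType) (k : nat) :
  2 * Num.sqrt 3 / 3 * sin (k%:R * pi / 3) = (sigma_seq`_(k %% 6))%:~R :> R.
Proof.
have q2 : Num.sqrt 3 ^+ 2 = 3 :> R by rewrite sqr_sqrtr.
have f1 : 2 * Num.sqrt 3 / 3 * sin (pi / 3) = 1 :> R.
  rewrite sin_pi3; transitivity (Num.sqrt 3 ^+ 2 / 3 : R); first by field.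
  by rewrite q2; field.
have f2 : sin (2 * pi / 3) = sin (pi / 3) :> R.
  have -> : 2 * pi / 3 = - (pi / 3) + pi :> R by field.
  by rewrite sinDpi sinN opprK.
have step j : sin ((j + 3)%:R * pi / 3) = - sin (j%:R * pi / 3) :> R.
  by rewrite -sinDpi natrD; congr sin; field.
have step6 j i : sin ((j * 6 + i)%:R * pi / 3) = sin (i%:R * pi / 3) :> R.
  elim: j => [//|j IH].
  by rewrite (_ : j.+1 * 6 + i = j * 6 + i + 3 + 3)%N ?step ?opprK //; lia.
have -> : k%:R = (k %/ 6 * 6 + k %% 6)%:R :> R by rewrite -divn_eq.
rewrite step6.
have : (k %% 6 < 6)%N by rewrite ltn_mod.
have s0 : sin (0%:R * pi / 3) = 0 :> R by rewrite !mul0r sin0.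
have s1 : 2 * Num.sqrt 3 / 3 * sin (1%:R * pi / 3) = 1 :> R by rewrite mul1r.
have s2 : 2 * Num.sqrt 3 / 3 * sin (2%:R * pi / 3) = 1 :> R by rewrite f2.
case: (k %% 6)%N => [|[|[|[|[|[|//]]]]]] _ /=.
- by rewrite s0 mulr0.
- by rewrite s1.
- by rewrite s2.
- by rewrite (step 0%N) s0 oppr0 mulr0.
- by rewrite (step 1%N) mulrN s1 rmorphN.
- by rewrite (step 2%N) mulrN s2 rmorphN.
Qed.

Lemma sigma_val (R : realType) (k : nat) : sigma R k = sigma_seq`_(k %% 6).
Proof. by rewrite /sigma sigma_formula intrKfloor. Qed.

Lemma sigmaE (R : realType) (k : nat) :
  (sigma R k)%:~R = 2 * Num.sqrt 3 / 3 * sin (k%:R * pi / 3) :> R.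
Proof. by rewrite sigma_val -sigma_formula. Qed.

(* Main.v *)
Require Import Defs.
From mathcomp Require Import all_boot all_order all_algebra.
From mathcomp Require Import finmap monalg reals.
From mathcomp Require Import zify.

(** The integers are shifted by two throughout: the integer [i] is called the
    position [i + 2], so that the interval [-1, ..., k] consists of the
    positions [1, ..., n] with [n = k + 2], and a virtual last letter
    [lambda_(l+1) = -2] sits at position [0].  With this letter, (U4) becomes
    the instance [j = l] of (U3), and (U2) also makes sense for the empty
    word, which it admits when [n] is a multiple of [3].

    Let [T_n] ([signed_sum n]) be the signed sum over the words of [U_(n-2)],
    including the empty word when it is admitted.  The first letter of such a
    word is either at most [k - 3] or equal to [k].  In the first case the word
    is one for [k - 3], with one more triple in its topmost gap.  In the second
    case the remaining word is, by (U3), one for [k - 2] or for [k - 3], with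
    the same number of triples.  Hence (lemma [signed_sum_rec])
      [T_(n+3) = - T_n + a_(n+1) (T_(n+1) + T_n)],
    and with [T_0 = 1], [T_1 = T_2 = 0] this gives [C_k = T_(k+1) + T_(k+2)]
    (lemma [C_signed_sum]): both sides satisfy the recurrence of the
    numerators.  The contributions of the empty word to the two summands add up
    to [- sigma(k)] (lemma [sigma_tau]), which proves the formula for [C_k].
    Moreover [phi] shifts the recurrence of the numerators to that of the
    denominators, so that [D_k = - phi (C_(k+1))] (lemma [D_phiC]).  As [phi]
    kills the words that end in [a_1], the formula for [D_k] follows.

    The signs require the number [g_k(m)] of disjoint triples to be computed
    (lemma [g_hits]).  Call a position inside a gap a hit when its distance to
    the nearest letter below it, possibly the virtual one, is a multiple of
    [3].  Any triple inside the gaps contains exactly one hit, so there are at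
    most as many disjoint triples as hits; and the triples that end at the hits
    lie in the gaps and are disjoint.  So [g_k(m)] is the number of hits, which
    is computed from the bottom up and changes as needed in the recurrence. *)

Set Implicit Arguments.
Unset Strict Implicit.
Unset Printing Implicit Defensive.

Import Order.TTheory GRing.Theory Num.Theory.

Local Open Scope ring_scope.

(** * Words indexing the monomials of U_k *)

Section Indices.
Local Open Scope nat_scope.

Definition top (l : seq nat) : nat := if l is x :: _ then x.+2 else 0.

(** (U1), (U3) and (U4), the virtual letter at position [0] making (U4) an
    instance of (U3); (U2) is not included, so that the tail of an admissible
    word is admissible. *)
Fixpoint admissible (l : seq nat) : bool :=
  if l is x :: l' then
    [&& 0 < x, top l' < x.+2, x.+2 != top l' + 1 %[mod 3] & admissible l']
  else true.

(** The three consecutive lists numbered [n], [n + 1], [n + 2]: the recurrence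
    reaches three steps back. *)
Fixpoint indices_window (n : nat) :
    seq (seq nat) * seq (seq nat) * seq (seq nat) :=
  if n is n'.+1 then
    let: (s0, s1, s2) := indices_window n' in
    (s1, s2, s0 ++ map (cons n) (s1 ++ s0))
  else ([:: [::]], [::], [::]).

(** The words for [k = n - 2], in the order that the recurrence of the
    signed sums needs. *)
Definition indices (n : nat) : seq (seq nat) := (indices_window n).1.1.

Lemma indices3 n :
  indices n.+3 = indices n ++ map (cons n.+1) (indices n.+1 ++ indices n).
Proof.
rewrite /indices /=.
by case: (indices_window n) => [[s0 s1] s2].
Qed.

Lemma nat3_ind (P : nat -> Prop) :
  P 0 -> P 1 -> P 2 -> (forall n, P n -> P n.+1 -> P n.+3) ->
  forall n, P n.
Proof.
move=> P0 P1 P2 PS n.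
suff [] : [/\ P n, P n.+1 & P n.+2] by [].
by elim: n => // n [Pn Pn1 Pn2]; split=> //; apply: PS.
Qed.

(** By (U2) the top letter of a word for [n + 3] is at position [n + 3] or at
    most [n]; in the first case (U3) leaves the residues of [n] and [n + 1] for
    the next letter. *)
Lemma mem_indices n l :
  (l \in indices n) = [&& admissible l, top l <= n & top l == n %[mod 3]].
Proof.
have top0 l' : admissible l' -> (top l' == 0) || (3 <= top l').
  by case: l' => //= x l' /and4P[].
elim/nat3_ind: n l => [||| n IH IH1] l.
- by rewrite inE; case: l => //= x l; rewrite andbF.
(* A letter is at position at least 3, and the empty word has residue 0. *)
- rewrite in_nil; apply/esym/negP => /and3P[/top0]; lia.
- rewrite in_nil; apply/esym/negP => /and3P[/top0]; lia.
rewrite indices3 mem_cat IH; apply/orP/idP => [[|/mapP[l' l'P ->]]|].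
- by move=> /and3P[-> /= ? ?]; lia.
- have /and3P[adm ltn md] : [&& admissible l', top l' <= n.+1
    & (top l' == n.+1 %[mod 3]) || (top l' == n %[mod 3])].
    by move: l'P; rewrite mem_cat IH1 IH => /orP[] /and3P[-> ? ?] /=; lia.
  by rewrite /= adm; lia.
- move=> /and3P[adm ltn md]; have [le|gt] := leqP (top l) n.
    by left; rewrite adm; lia.
  right; case: l adm ltn md gt => //= x l /and4P[x0 tx xm adm] ltn md gt.
  have -> : x = n.+1 by lia.
  apply: map_f; rewrite mem_cat IH IH1 adm /=; lia.
Qed.

Lemma indices_uniq n : uniq (indices n).
Proof.
elim/nat3_ind: n => // n IH IH1.
rewrite indices3 cat_uniq IH map_inj_uniq; last by move=> ? ? [].
rewrite cat_uniq IH IH1 andbT /=; apply/andP; split; last first.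
  by apply/hasPn => l; rewrite !mem_indices; lia.
by apply/hasPn => _ /mapP[l _ ->]; rewrite mem_indices /=; lia.
Qed.

(** * Hits *)

(** Distance from position [p] to the nearest letter of [l] below or at it,
    position [0] counting as a letter.  The letter at position [p'.+1] is
    [p'.-1]; for [p' = 0] this is the truncated value [0], never a letter. *)
Fixpoint run (l : seq nat) (p : nat) : nat :=
  if p is p'.+1 then if p'.-1 \in l then 0 else (run l p').+1 else 0.

Definition hit l p := (0 < run l p) && (3 %| run l p).

Definition hits l n : seq nat := [seq p <- iota 1 n | hit l p].

Lemma iotaS_rcons m n : iota m n.+1 = rcons (iota m n) (m + n).
Proof. by rewrite -addn1 iotaD cats1. Qed.

Lemma size_hitsS l n : size (hits l n.+1) = size (hits l n) + hit l n.+1.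
Proof.
rewrite /hits iotaS_rcons filter_rcons.
by case: ifP; rewrite ?size_rcons ?addn1 ?addn0.
Qed.

Lemma mem_admissible l y : admissible l -> y \in l -> 0 < y /\ y.+2 <= top l.
Proof.
elim: l => //= x l IH /and4P[x0 tx _ adm]; rewrite inE => /predU1P[->|/IH] //.
by case=> //; lia.
Qed.

Lemma run_top l n : admissible l -> top l <= n -> run l n = n - top l.
Proof.
move=> adm; elim: n => [|n IH] le /=; first by [].
case: ifP => [/(mem_admissible adm)|/negbT nin]; first by lia.
have ne : top l != n.+1.
  apply: contraNneq nin; case: l {adm IH le} => //= x l [<-].
  by rewrite mem_head.
rewrite IH; lia.
Qed.

Lemma run_cons x l p : 0 < x -> p < x.+2 -> run (x :: l) p = run l p.
Proof.
move=> x0; elim: p => //= p IH lt; rewrite inE IH; last by lia.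
by case: eqP => //=; lia.
Qed.

(** When the top gap has length divisible by [3], three more positions
    contribute exactly one more hit. *)
Lemma size_hits3 l n :
  admissible l -> top l <= n -> top l = n %[mod 3] ->
  size (hits l n.+3) = (size (hits l n)).+1.
Proof.
move=> adm le md; rewrite !size_hitsS /hit !run_top //; lia.
Qed.

(** The new letter is at position [n + 3].  Its gap has length congruent to [1]
    or [2] modulo [3], so its topmost one or two positions are not hits. *)
Lemma size_hits_cons l n :
  admissible l -> top l <= n.+1 -> top l <> n.+2 %[mod 3] ->
  size (hits (n.+1 :: l) n.+3) =
    size (hits l (if top l == n %[mod 3] then n else n.+1)).
Proof.
move=> adm le md.
have -> : size (hits (n.+1 :: l) n.+3) = size (hits l n.+2).
  rewrite size_hitsS /hit /= mem_head addn0; congr size.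
  apply: eq_in_filter => p; rewrite mem_iota => pP.
  by rewrite /hit run_cons //; lia.
rewrite size_hitsS /hit run_top //; last by lia.
case: ifP => e; last by lia.
have {}le : top l <= n by lia.
rewrite size_hitsS /hit run_top //; lia.
Qed.

Lemma size_hits_nil n : 3 %| n -> size (hits [::] n) = n %/ 3.
Proof.
move=> /dvdnP[q ->]; rewrite mulnK //; elim: q => // q IH.
rewrite (_ : q.+1 * 3 = (q * 3).+3); last by lia.
by rewrite size_hits3 ?IH //= mod0n modnMl.
Qed.

End Indices.
(** * The maximal number of disjoint triples *)

Lemma run_gt0 l p : (0 < run l p)%N = (0 < p)%N && (p.-2 \notin l).
Proof. by case: p => //= p; case: ifP. Qed.

Lemma run_pred l p : (0 < run l p.+1)%N -> run l p.+1 = (run l p).+1.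
Proof. by move=> /=; case: ifP. Qed.

(** Two hits in the same gap differ by a multiple of [3]; in different gaps, the
    two lowest positions of the upper gap lie between them. *)
Lemma hit_sep l p q : hit l p -> hit l q -> (p < q)%N -> (p + 3 <= q)%N.
Proof.
case: q => [|[|q]] /andP[rp dp] /andP[rq dq]; [by []|by case: p rp dp|].
have := run_pred rq; have [/run_pred|] := ltnP 0 (run l q.+1); last by lia.
move=> e1 e2 lt; have [//|ge] := leqP (p + 3) q.+2.
have [e|e] : p = q.+1 \/ p = q by lia.
- by move: dp; rewrite e; lia.
- by move: dp; rewrite e; lia.
Qed.

(** Inside a gap, [run] increases by one from each position to the next. *)
Lemma hit_window l p :
  (0 < run l p)%N -> (0 < run l p.+1)%N -> (0 < run l p.+2)%N ->
  [|| hit l p, hit l p.+1 | hit l p.+2].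
Proof. by rewrite /hit => r0 /run_pred e1 /run_pred e2; lia. Qed.

Lemma mem_gaps n m x :
  reflect (exists2 p, [&& (p <= n)%N & (0 < run (lambda m) p)%N] & x = p%:Z - 2)
    (x \in gaps (n%:Z - 2) m).
Proof.
have lambda0 : 0%N \notin lambda m by apply/mapP => -[].
rewrite /gaps subrK absz_nat in_fsetD; apply: (iffP andP) => [[]|[p pP ->]].
  move=> xl /imfsetP[i /= iP xi]; rewrite mem_iota in iP.
  rewrite {x}xi in xl *.
  exists i.+1; last by lia.
  rewrite run_gt0 /= (_ : (i < n)%N) /=; last by lia.
  case: i iP xl => // i iP; apply: contra => il.
  by apply/imfsetP; exists i => //=; lia.
move: pP; rewrite run_gt0 => /and3P[pn p0 pl]; split; last first.
  by apply/imfsetP; exists p.-1 => /=; rewrite ?mem_iota; lia.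
apply/imfsetP => -[j /= jl e]; case/negP: pl.
have [j0|jgt0] := posnP j; first by rewrite j0 (negbTE lambda0) in jl.
by rewrite (_ : p.-2 = j) //; lia.
Qed.

(** Written with the integers, not the positions: the set ends at position
    [p], the integer [p - 2]. *)
Definition triple (p : nat) : {fset int} :=
  [fset (p%:Z - 4)%R; (p%:Z - 4 + 1)%R; (p%:Z - 4 + 2)%R]%fset.

(** Disjoint triples contain distinct hits. *)
Lemma g_leq_hits n m : (g (n%:Z - 2) m <= size (hits (lambda m) n))%N.
Proof.
set l := lambda m.
pose H := [fset (p%:Z - 2)%R | p in hits l n]%fset.
have cardH : #|` H| = size (hits l n).
  rewrite card_imfset /=; last by move=> p q /= /addIr[].
  by rewrite undup_id // filter_uniq // iota_uniq.
rewrite -cardH /g; apply/bigmax_leqP_seq => F FP /andP[tF /forallP F3].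
have hitF B : B \in F -> (0 < \sum_(x <- B) (x \in H))%N.
  move=> BF; have /fsubsetP BG : (B `<=` gaps (n%:Z - 2) m)%fset.
    by move: FP; rewrite fpowersetE => /fsubsetP/(_ _ BF); rewrite fpowersetE.
  suff [x xB xH] : exists2 x, x \in B & x \in H.
    by rewrite (big_fsetD1 x) //= xH.
  have /existsP[[x xB] /= /eqP eB] := F3 [` BF]%fset; rewrite /= in eB xB.
  have B1 : x + 1 \in B by rewrite eB !inE eqxx ?orbT.
  have B2 : x + 2 \in B by rewrite eB !inE eqxx ?orbT.
  have /mem_gaps[p /andP[pn rp] xp] := BG _ xB.
  have /mem_gaps[q /andP[qn rq] xq] := BG _ B1.
  have /mem_gaps[r /andP[rn rr] xr] := BG _ B2.
  have eq_ : q = p.+1 by lia.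
  have er : r = p.+2 by lia.
  subst q r.
  have inH q : (q <= n)%N -> hit l q -> q%:Z - 2 \in H.
    move=> qn' hq; apply/imfsetP; exists q => //=.
    rewrite mem_filter hq mem_iota /=.
    by case/andP: hq; case: q qn' => //= q; lia.
  case/or3P: (hit_window rp rq rr) => h.
  - by exists x => //; rewrite xp inH.
  - by exists (x + 1) => //; rewrite xq inH.
  - by exists (x + 2) => //; rewrite xr inH.
have le1 : (#|` F| <= \sum_(B <- F) \sum_(x <- B) (x \in H))%N.
  rewrite -sum1_size big_seq [X in (_ <= X)%N]big_seq.
  by apply: leq_sum => B; apply: hitF.
apply: leq_trans le1 _.
rewrite -(big_trivIfset _ (fun x => (x \in H) : nat) tF) /=.
rewrite -big_mkcond sum1_count -size_filter.
apply: uniq_leq_size; first by rewrite filter_uniq // fset_uniq.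
by move=> x; rewrite mem_filter => /andP[].
Qed.

(** The triples ending at the hits realise the maximum. *)
Lemma hits_leq_g n m : (size (hits (lambda m) n) <= g (n%:Z - 2) m)%N.
Proof.
set l := lambda m.
pose F := [fset triple p | p in hits l n]%fset.
have inT p x : (x \in triple p) = (p%:Z - 4 <= x <= p%:Z - 2).
  by rewrite !inE; lia.
have cardF : #|` F| = size (hits l n).
  rewrite card_imfset /=; last first.
    move=> p q /fsetP e; have := e (p%:Z - 2); have := e (q%:Z - 2).
    by rewrite !inT; lia.
  by rewrite undup_id // filter_uniq // iota_uniq.
rewrite -cardF /g; apply: (leq_bigmax_seq F).
  rewrite fpowersetE; apply/fsubsetP => _ /imfsetP[p /= pH ->].
  rewrite fpowersetE; apply/fsubsetP => x; rewrite inT => xp.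
  move: pH; rewrite mem_filter mem_iota => /andP[hp pn].
  case/andP: hp => rp dp.
  (* A hit has run at least 3, hence position at least 3. *)
  case: p rp dp pn xp => [|[|[|p]]] rp dp pn xp;
    [by []|by move: rp dp => /=; case: (0%N \in l)
    |by move: rp dp => /=; case: (0%N \in l)|].
  have e1 := run_pred rp.
  have r1 : (0 < run l p.+2)%N by lia.
  have e2 := run_pred r1.
  have r2 : (0 < run l p.+1)%N by lia.
  apply/mem_gaps.
  have [->|->|->] : [\/ x = p.+3%:Z - 2, x = p.+2%:Z - 2 | x = p.+1%:Z - 2].
    have : [|| x == p.+3%:Z - 2, x == p.+2%:Z - 2 | x == p.+1%:Z - 2] by lia.
    by case/or3P => /eqP; [constructor 1|constructor 2|constructor 3].
  - by exists p.+3 => //; apply/andP; split=> //; lia.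
  - by exists p.+2 => //; apply/andP; split=> //; lia.
  - by exists p.+1 => //; apply/andP; split=> //; lia.
apply/andP; split; last first.
  apply/forallP => -[_ /= /imfsetP[p _ ->]]; apply/existsP.
  have h : p%:Z - 4 \in triple p by rewrite inT; lia.
  by exists [` h]%fset.
apply/trivIfsetP => _ _ /imfsetP[p /= pH ->] /imfsetP[q /= qH ->] ne.
have npq : p != q by apply: contraNneq ne => ->.
have hp : hit l p by move: pH; rewrite mem_filter => /andP[].
have hq : hit l q by move: qH; rewrite mem_filter => /andP[].
apply/fdisjointP => x; rewrite !inT.
have [lt|gt|e] := ltngtP p q; last by rewrite e eqxx in npq.
- by have := hit_sep hp hq lt; lia.
- by have := hit_sep hq hp gt; lia.
Qed.

Lemma g_hits n m : g (n%:Z - 2) m = size (hits (lambda m) n).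
Proof. by apply/anti_leq; rewrite g_leq_hits hits_leq_g. Qed.

(** * Signed sums and the continued fraction *)

Definition weight (n : nat) (l : seq nat) : ncpoly :=
  (-1) ^+ size (hits l n) * \prod_(j <- l) a j.

Definition signed_sum (n : nat) : ncpoly := \sum_(l <- indices n) weight n l.

Lemma top_step k n t : (t <= k)%N -> t = k %[mod 3]%N -> k \in [:: n; n.+1] ->
  [/\ (t <= n.+1)%N, (t <> n.+2 %[mod 3])%N
    & (if (t == n %[mod 3])%N then n else n.+1) = k].
Proof.
rewrite !inE => le md kn; split; [lia|lia|case: ifP; lia].
Qed.

(** The words for [n + 3] whose top letter is lower come from those for [n]
    with one more hit, hence the minus sign; prepending [a_(n+1)] to the words
    for [n + 1] or [n] leaves the number of hits unchanged. *)
Lemma signed_sum_rec n :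
  signed_sum n.+3 =
    - signed_sum n + a n.+1 * (signed_sum n.+1 + signed_sum n).
Proof.
have weightS l k : l \in indices k -> k \in [:: n; n.+1] ->
    weight n.+3 (n.+1 :: l) = a n.+1 * weight k l.
  rewrite mem_indices /weight => /and3P[adm le /eqP md] kn.
  have [le1 md1 e] := top_step le md kn.
  rewrite (size_hits_cons adm le1 md1) e big_cons.
  by rewrite mulrA [RHS]mulrA (commr_sign (a n.+1)).
rewrite {1}/signed_sum indices3 big_cat big_map big_cat /=; congr (_ + _).
  rewrite /signed_sum -sumrN; apply: eq_big_seq => l.
  rewrite mem_indices => /and3P[adm le /eqP md].
  by rewrite /weight size_hits3 // exprS mulN1r mulNr.
have consT k : k \in [:: n; n.+1] ->
    \sum_(l <- indices k) weight n.+3 (n.+1 :: l) = a n.+1 * signed_sum k.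
  move=> kn; rewrite [RHS]mulr_sumr.
  by apply: eq_big_seq => l lk; apply: weightS.
by rewrite mulrDr !consT // !inE eqxx ?orbT.
Qed.

Lemma signed_sum0 : signed_sum 0 = 1.
Proof.
by rewrite /signed_sum /indices /= big_seq1 /weight big_nil mulr1 expr0.
Qed.

Lemma signed_sum1 : signed_sum 1 = 0.
Proof. by rewrite /signed_sum /indices /= big_nil. Qed.

Lemma signed_sum2 : signed_sum 2 = 0.
Proof. by rewrite /signed_sum /indices /= big_nil. Qed.

Lemma nat2_ind (P : nat -> Prop) :
  P 0%N -> P 1%N -> (forall n, P n -> P n.+1 -> P n.+2) -> forall n, P n.
Proof.
move=> P0 P1 PS n; suff [] : P n /\ P n.+1 by [].
by elim: n => // n [Pn Pn1]; split=> //; apply: PS.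
Qed.

Lemma cf_recE x0 x1 k :
  cf_rec x0 x1 k.+2 = (-1 + a k.+2) * cf_rec x0 x1 k + cf_rec x0 x1 k.+1.
Proof. reflexivity. Qed.

(** The recurrence of the numerators, for sums of consecutive terms of a
    sequence that satisfies [z' = - x + c (y + x)]. *)
Lemma cf_step (A : pzRingType) (c x y z : A) :
  (-1 + c) * (x + y) + (y + z) = z + (- x + c * (y + x)).
Proof.
rewrite mulrDl mulN1r opprD addrAC addrA subrK.
by rewrite [x + y]addrC [- x + z]addrC -addrA.
Qed.

Lemma C_signed_sum k : C k = signed_sum k.+1 + signed_sum k.+2.
Proof.
elim/nat2_ind: k => [||k IH IH1].
- by rewrite signed_sum1 signed_sum2 addr0.
- by rewrite signed_sum2 signed_sum_rec signed_sum0 signed_sum1 !add0r mulr1.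
rewrite /C cf_recE -/(C k) -/(C k.+1).
by rewrite IH IH1 [signed_sum k.+4]signed_sum_rec cf_step.
Qed.

Lemma phiC_rec k :
  phi (C k.+3) = (-1 + a k.+2) * phi (C k.+1) + phi (C k.+2).
Proof.
rewrite /C cf_recE -/(C k.+1) -/(C k.+2).
by rewrite (rmorphD phi) (rmorphM phi) (rmorphD phi) (rmorphN1 phi) /= phi_a.
Qed.

(** Since [phi] lowers every index by one, it turns the recurrence of
    [C_(k+1)] into that of [D_k]; the initial values agree up to sign because
    [phi (-1 + a_1) = -1]. *)
Lemma D_phiC k : D k = - phi (C k.+1).
Proof.
have phiC1 : phi (C 1) = -1.
  by rewrite (rmorphD phi) (rmorphN1 phi) /= phi_a1 addr0.
elim/nat2_ind: k => [||k IH IH1].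
- by rewrite phiC1 opprK.
- by rewrite /C cf_recE mulr0 add0r phiC1 opprK.
rewrite /D cf_recE -/(D k) -/(D k.+1) phiC_rec opprD IH IH1.
by rewrite mulrN.
Qed.

(** * Translation to the sets U_k *)

Lemma U_index_admissible n x l :
  U_index (n%:Z - 2) (x :: l) =
    [&& admissible (x :: l), (top (x :: l) <= n)%N
      & top (x :: l) == n %[mod 3]]%N.
Proof.
rewrite /U_index.
elim: l x n => [|y l IH] x n; first by rewrite /=; lia.
(* Applied to its own first letter as bound, the tail meets (U1) and (U2)
   trivially, so that only conditions also imposed on the word remain. *)
have := IH y y.+2.
rewrite (_ : y.+2%:Z - 2 = y%:Z); last by lia.
rewrite /= lexx leqnn !eqxx !andbT /=.
case: (path gtn y l); case: (path _ y l); case: (admissible l);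
 case: (0 < last y l)%N; case: (last y l != _ %[mod _])%N;
 rewrite ?andbT ?andbF /=; lia.
Qed.

Lemma lambda_word l : 0%N \notin l -> lambda (FMonom (map predn l)) = l.
Proof.
move=> l0; rewrite /lambda /= -map_comp -[RHS]map_id.
by apply/eq_in_map => -[|x] //; rewrite (negbTE l0).
Qed.

Lemma lambda_inj : injective lambda.
Proof.
move=> m1 m2 /inj_map e; apply/eqP; rewrite fmP; apply/eqP/e.
by move=> ? ? [].
Qed.

Lemma perm_U_indices n :
  perm_eq (map lambda (U (n%:Z - 2))) [seq l <- indices n | l != [::]].
Proof.
apply: uniq_perm.
- by rewrite map_inj_uniq ?fset_uniq //; apply: lambda_inj.
- by rewrite filter_uniq // indices_uniq.
move=> l; rewrite mem_filter mem_indices; apply/mapP/idP => [[m mU ->]|].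
  move: mU; rewrite in_U; case: (lambda m) => // x l'.
  by rewrite U_index_admissible.
case: l => // x l; set w := x :: l => P.
have w0 : 0%N \notin w.
  by apply/negP; case/and3P: P => _ adm _ /(mem_admissible adm)[].
exists (FMonom (map predn w)); rewrite ?lambda_word //.
by rewrite in_U lambda_word // U_index_admissible.
Qed.

(** The contribution of the empty word to [signed_sum n]. *)
Definition tau (n : nat) : int := if (3 %| n)%N then (-1) ^+ (n %/ 3) else 0.

Lemma sum_U n :
  \sum_(m <- U (n%:Z - 2)) (-1) ^+ g (n%:Z - 2) m * << m >>
    = signed_sum n - (tau n)%:~R :> ncpoly.
Proof.
transitivity (\sum_(l <- map lambda (U (n%:Z - 2))) weight n l).
  by rewrite big_map; apply: eq_bigr => m _; rewrite g_hits aE.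
rewrite (perm_big _ (perm_U_indices n)) big_filter /signed_sum.
have nilE : ([::] \in indices n) = (3 %| n)%N by rewrite mem_indices /=; lia.
rewrite /tau -nilE; case: ifP => nilI.
  rewrite [in RHS](big_rem _ nilI) /= rem_filter ?indices_uniq //.
  rewrite big_filter {2}/weight size_hits_nil -?nilE // big_nil mulr1.
  by rewrite rmorphXn rmorphN1 addrAC subrr add0r.
rewrite rmorph0 subr0 -big_filter; congr (\sum_(l <- _) _).
apply/all_filterP/allP => l lI; apply: contraFneq nilI => <- //.
Qed.

(** Both sides have period [6] in [k], which leaves six cases. *)
Lemma sigma_tau (R : realType) k : sigma R k = - (tau k.+1 + tau k.+2).
Proof.
rewrite sigma_val /tau (divn_eq k 6) modnMDl modn_mod.
have : (k %% 6 < 6)%N by rewrite ltn_mod.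
set q := (k %/ 6)%N; have sgn d : (-1) ^+ (q * 2 + d) = (-1) ^+ d :> int.
  by rewrite exprD mulnC exprM sqrrN !expr1n mul1r.
case: (k %% 6)%N => [|[|[|[|[|[|//]]]]]] _ /=.
all: rewrite -!addnS.
all: do !(rewrite dvdn_addr; last by rewrite dvdn_mull).
all: rewrite /= ?divnDl ?dvdn_mull //.
all: rewrite -?[(6%N)]/(2 * 3)%N ?mulnA ?mulnK ?sgn //.
Qed.

Lemma phi_word_last1 m :
  (0 < last 0 (lambda m) <= 1)%N -> phi << m >> = 0.
Proof.
rewrite /phi mmapU mul1r /phi_mon /lambda.
case: m => s /=; case/lastP: s => // s i.
rewrite map_rcons last_rcons big_rcons /=.
by case: i => //=; rewrite ?mulr0 ?mul0r.
Qed.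

(** The words that the condition on the last letter excludes end in [a_1],
    which [phi] maps to [0]. *)
Lemma sum_phi_U n :
  \sum_(m <- U (n%:Z - 2) | (1 < last 0 (lambda m))%N)
      (-1) ^+ g (n%:Z - 2) m * phi << m >>
    = phi (signed_sum n) - (tau n)%:~R :> ncpoly.
Proof.
rewrite -(rmorph_int phi) -(raddfB phi) -sum_U (raddf_sum phi) /=.
rewrite big_mkcond; apply: eq_big_seq => m; rewrite in_U.
move=> /and5P[_ /and3P[_ _ l1] _ _ _].
rewrite (rmorphM phi) (rmorphXn phi) (rmorphN1 phi) /=.
case: ifP => [_|lt]; first by [].
by rewrite phi_word_last1 ?mulr0 // l1 leqNgt lt.
Qed.

Lemma addr_sub_pair (V : zmodType) (s t x y : V) :
  s + t + (x - s) + (y - t) = x + y.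
Proof. by rewrite -addrA addrACA ![_ + (_ - _)]addrC !subrK. Qed.

Theorem corollary19 (R : realType) (k : nat) :
  C k = - (sigma R k)%:~R
        + \sum_(m <- U (k%:Z - 1)) (-1) ^+ g (k%:Z - 1) m * << m >>
        + \sum_(m <- U k%:Z) (-1) ^+ g k%:Z m * << m >>
  /\
  D k = (sigma R k.+1)%:~R
        - \sum_(m <- U k%:Z | (1 < last 0 (lambda m))%N)
             (-1) ^+ g k%:Z m * phi << m >>
        - \sum_(m <- U (k%:Z + 1) | (1 < last 0 (lambda m))%N)
             (-1) ^+ g (k%:Z + 1) m * phi << m >>.
Proof.
have e1 : k%:Z - 1 = k.+1%:Z - 2 by lia.
have e2 : k%:Z = k.+2%:Z - 2 by lia.
have e3 : k%:Z + 1 = k.+3%:Z - 2 by lia.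
split.
  rewrite e1 e2 !sum_U sigma_tau C_signed_sum rmorphN rmorphD opprK.
  by rewrite addr_sub_pair.
rewrite e3 e2 !sum_phi_U sigma_tau D_phiC C_signed_sum raddfD rmorphN rmorphD.
by rewrite -!opprD addr_sub_pair.
Qed.
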